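(* Let $G$ be a commutative group with unit $0_G$. Let $\mathcal{Q}$ and $\mathcal{R}$ be symmetric hull structures on $G$ such that $\mathcal{R}$ is basic, and $\mathcal{Q}$ is $\mathcal{R}$-enhancible and is either additive or translation invariant. Let $\tau$ be a group topology on $G$ which is both a $\mathcal{Q}$-topology and an $\mathcal{R}$-topology. Then: (i) $\tau$ is generated by a collection of symmetric $\tau$-continuous $[0,1]$-valued $\mathcal{Q}\cap\mathcal{R}$-pseudo-norms. (ii) If the filter $\tau_0$ of $\tau$-neighborhoods of $0_G$ has a countable base, then $\tau$ is generated by a single symmetric $\tau$-continuous $[0,1]$-valued $\mathcal{Q}\cap\mathcal{R}$-pseudo-norm. (iii) If $f:G\to\mathbb{R}$ with $f(0_G)=0$ is $\tau$-continuous at $0_G$, then there is a symmetric $\tau$-continuous $\mathcal{Q}\cap\mathcal{R}$-pseudo-norm $\rho$ such that $f$ is $\rho$-continuous at $0_G$ (i.e. continuous at $0_G$ with respect to the topology generated by $\rho$). In particular, $\ker\rho\subset\ker f$, where $\ker\rho=\rho^{-1}(0)$ and $\ker f=f^{-1}(0)$. (iv) If $\tau$ is submetrizable (i.e. there is a metrizable topology on $G$ weaker than $\tau$), then there is a total (i.e. $\ker\rho=\{0_G\}$) symmetric $\tau$-continuous $\mathcal{Q}\cap\mathcal{R}$-pseudo-norm $\rho$. (v) If $\lambda$ is a $\tau$-continuous pseudo-norm on $G$, then there is a symmetric $\tau$-continuous $[0,1]$-valued $\mathcal{Q}\cap\mathcal{R}$-pseudo-norm $\rho$ on $G$ such that $\lambda$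 is $\rho$-continuous.
   Context: A hull structure on a set $X$ is a collection $\mathcal{Q}$ of subsets of $X$ closed under arbitrary intersections and containing $X$. It is $1$-algebraic if it is also closed under arbitrary unions; for a $1$-algebraic $\mathcal{R}$ and $A\subset X$ the core is $A_{\mathcal{R}}:=\bigcup\{R\in\mathcal{R}: R\subset A\}$. Let $G$ be a commutative group, $\mathcal{Q},\mathcal{R}$ hull structures on $G$. - $\mathcal{Q}$ is additive if $Q,Q'\in\mathcal{Q}$ implies $Q+Q'\in\mathcal{Q}$. - $\mathcal{Q}$ is translation invariant if for every $e\in G$ and $Q\in\mathcal{Q}$ the preimage of $Q$ under $g\mapsto e+g$ is in $\mathcal{Q}$. - $\mathcal{Q}$ is symmetric if $Q\in\mathcal{Q}$ implies $-Q\in\mathcal{Q}$. - $\mathcal{R}$ is basic if it is $1$-algebraic, additive and $\{0_G\}\in\mathcal{R}$. - For $1$-algebraic $\mathcal{R}$, $\mathcal{Q}$ is $\mathcal{R}$-enhancible if $0_G\in Q_{\mathcal{R}}\in\mathcal{Q}$ for every $Q\in\mathcal{Q}$ with $0_G\in Q$. A topology $\tau$ on $G$ is additive if addition $(G,\tau)\times(G,\tau)\to(G,\tau)$ is continuous, and a group topology if moreover $g\mapsto -g$ is continuous. $\tau_0$ denotes the filter of $\tau$-neighborhoods of $0_G$. $\tau$ is a $\mathcal{Q}$-topology if $\tau_0\cap\mathcal{Q}$ is a base for $\tau_0$. ''Weaker'' is not strict. A pseudo-norm on $G$ is a subadditive function $\rho:G\to[0,+\infty]$ with $\rho(0_G)=0$.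 It is symmetric if $\rho(-g)=\rho(g)$ for all $g$. It is a $\mathcal{Q}$-pseudo-norm if $\rho^{-1}[0,r]\in\mathcal{Q}$ for every $r\ge 0$. A symmetric pseudo-norm $\rho$ generates the topology of the pseudo-metric $d_\rho(g,h)=\rho(g-h)$ (values $+\infty$ allowed). A collection of symmetric pseudo-norms generates the weakest additive topology in which each of them is continuous at $0_G$; in it $g_p\to g$ iff $\rho(g_p-g)\to0$ for each $\rho$ in the collection. A pseudo-norm $\lambda$ is $\rho$-continuous ($\rho$ a symmetric pseudo-norm) if it is continuous as a map into $[0,+\infty]$ with respect to the topology generated by $\rho$; if $\lambda$ is symmetric, this is equivalent to the topology generated by $\lambda$ being weaker than that generated by $\rho$. *)

(* Defs.v *)
From HB Require Import structures.
From mathcomp Require Import all_boot all_order all_algebra.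
From mathcomp Require Import all_classical all_reals all_analysis.

Set Implicit Arguments.
Unset Strict Implicit.
Unset Printing Implicit Defensive.

Import Order.TTheory GRing.Theory Num.Theory.
Import numFieldNormedType.Exports.

Local Open Scope classical_set_scope.
Local Open Scope ring_scope.

Definition hull_structure (X : Type) (Q : set (set X)) : Prop :=
  Q setT /\ forall F : set (set X), F `<=` Q -> Q (\bigcap_(A in F) A).

(* The empty family is allowed, so a 1-algebraic structure contains [set0]. *)
Definition algebraic1 (X : Type) (P : set (set X)) : Prop :=
  hull_structure P /\ forall F : set (set X), F `<=` P -> P (\bigcup_(A in F) A).

Definition core (X : Type) (P : set (set X)) (A : set X) : set X :=
  \bigcup_(B in [set B | P B /\ B `<=` A]) B.

Section GroupHulls.
Variable G : zmodType.
Implicit Types Q P : set (set G).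

Definition additive_hull Q : Prop :=
  forall A B, Q A -> Q B -> Q [set x + y | x in A & y in B].

Definition translation_invariant_hull Q : Prop :=
  forall (e : G) A, Q A -> Q ((fun g => e + g) @^-1` A).

Definition symmetric_hull Q : Prop :=
  forall A, Q A -> Q [set - x | x in A].

Definition basic_hull P : Prop :=
  [/\ algebraic1 P, additive_hull P & P [set 0]].

Definition enhancible P Q : Prop :=
  forall A, Q A -> A 0 -> core P A 0 /\ Q (core P A).

End GroupHulls.

Definition filter_base (T : Type) (F B : set_system T) : Prop :=
  F = filter_from B id.

Definition hull_topology (G : topologicalZmodType) (Q : set (set G)) : Prop :=
  filter_base (nbhs (0 : G)) (nbhs (0 : G) `&` Q).

(* An arbitrary topology on T is an element of the HB class [Topological T]. *)
Section Topologies.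
Variable T : Type.
Implicit Types s t : Topological T.

Definition weaker_topology s t : Prop :=
  (@open (Topological.Pack s) : set (set T)) `<=` @open (Topological.Pack t).

Definition same_topology s t : Prop :=
  weaker_topology s t /\ weaker_topology t s.

Definition metrizable_topology (R : realType) s : Prop :=
  exists m : Metric R T, same_topology s (Topological.class (Metric.Pack m)).

Definition submetrizable_topology (R : realType) t : Prop :=
  exists2 s, metrizable_topology R s & weaker_topology s t.

End Topologies.

Definition additive_topology (G : zmodType) (s : Topological G) : Prop :=
  let T := Topological.Pack s in
  continuous (fun x : T * T => ((x.1 : G) + (x.2 : G)) : T).

Section PseudoNorms.
Variables (R : realType) (G : zmodType).
Implicit Type rho : G -> \bar R.

Definition pseudo_norm rho : Prop :=
  [/\ forall g, (0 <= rho g)%E, rho 0 = 0%E &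
      forall g h, (rho (g + h)%R <= rho g + rho h)%E].

Definition symmetric_fun rho : Prop := forall g, rho (- g) = rho g.

Definition hull_pseudo_norm (Q : set (set G)) rho : Prop :=
  pseudo_norm rho /\ forall r : R, 0 <= r -> Q (rho @^-1` `[0%E, r%:E]).

Definition unit_valued rho : Prop := forall g, (0 <= rho g <= 1)%E.

(* The group G with the topology whose open sets are the sets containing,
   around each of their points, a ball of [d_rho(g, h) = rho (g - h)]; this is
   the topology of the pseudo-metric [d_rho] when rho is a symmetric
   pseudo-norm, but it is a topology for any rho. *)
Definition pnorm_space (rho : G -> \bar R) : Type := G.

Definition pnorm_open rho : set (set G) :=
  [set A | forall g, A g ->
    exists2 e : R, 0 < e & [set h | (rho (g - h)%R < e%:E)%E] `<=` A].

Lemma pnorm_openT rho : pnorm_open rho setT.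
Proof. by move=> g _; exists 1. Qed.

Lemma pnorm_openI rho : setI_closed (pnorm_open rho).
Proof.
move=> A B oA oB g [/oA [d d0 dA] /oB [e e0 eB]].
exists (Num.min d e) => [|h /= gh]; first by rewrite lt_min d0.
by split; [apply: dA|apply: eB]; apply: (lt_le_trans gh);
  rewrite lee_fin ge_min lexx ?orbT.
Qed.

Lemma pnorm_open_bigU rho (I : Type) (f : I -> set G) :
  (forall i, pnorm_open rho (f i)) -> pnorm_open rho (\bigcup_i f i).
Proof.
move=> fo g [i _ /fo [e e0 ef]]; exists e => // h /ef fh; by exists i.
Qed.

HB.instance Definition _ rho := Choice.on (pnorm_space rho).
HB.instance Definition _ rho := @isOpenTopological.Build (pnorm_space rho)
  (pnorm_open rho) (@pnorm_openT rho) (@pnorm_openI rho) (@pnorm_open_bigU rho).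

Definition pnorm_topology rho : Topological G :=
  Topological.class (pnorm_space rho).

Definition pnorms_continuous0 (N : set (G -> \bar R)) (s : Topological G) :=
  forall rho, N rho ->
    continuous_at ((0 : G) : Topological.Pack s)
                  (rho : Topological.Pack s -> \bar R).

Definition generated_topology (N : set (G -> \bar R)) (t : Topological G) :=
  [/\ additive_topology t, pnorms_continuous0 N t &
      forall s : Topological G, additive_topology s ->
        pnorms_continuous0 N s -> weaker_topology t s].

End PseudoNorms.

(* Main.v *)
(** Every neighbourhood of 0 contains the [P]-core of a neighbourhood in [Q], so
there are chains [U k] of symmetric neighbourhoods in [Q `&` P] with
[U k.+1 + U k.+1 <= U k].  If [Q] is additive, the Birkhoff-Kakutani
construction (gauge of the sums of [U k] along binary expansions) stays in
[Q `&` P].  If [Q] is translation invariant, take the Birkhoff-Kakutani norm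
[rho] of such a chain below some [B] in [Q], and let [D] be the [rho]-distance
to the complement of [B], truncated at 1: the sublevel sets of
[x |-> sup_y (D y - D (x + y))] are intersections of translates of [B], hence lie
in [Q], and their symmetrized [P]-cores are the sublevel sets of the wanted norm.
Finally, countably many neighbourhoods are controlled simultaneously by
[sup_n min (rho_n, 1 / (n + 1))]; the clauses follow by choosing them suitably. *)

Require Import Defs.
From mathcomp Require Import all_boot all_order all_algebra.
From mathcomp Require Import all_classical all_reals all_analysis.
From mathcomp Require Import ring lra.
(* The imports above shadow [core]. *)
Import Defs.

Set Implicit Arguments.
Unset Strict Implicit.
Unset Printing Implicit Defensive.

Import Order.TTheory GRing.Theory Num.Theory.
Import numFieldNormedType.Exports.

Local Open Scope classical_set_scope.
Local Open Scope ring_scope.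

(** Norms stay real-valued until the final clauses, so that infima, suprema and linear arithmetic
    over [R] apply directly. *)
Definition unit_norm {R : realType} {G : zmodType} (rho : G -> R) : Prop :=
  [/\ forall g, 0 <= rho g <= 1, rho 0 = 0, forall g, rho (- g) = rho g &
      forall g h, rho (g + h) <= rho g + rho h].

(** * Dyadic rationals *)

Definition dyadic (R : realType) (k m : nat) : R := m%:R / 2 ^+ k.

Section Dyadic.
Variable R : realType.
Implicit Types (r s : R) (k m n : nat).

Lemma dyadic_gt0 k m : 0 < dyadic R k m.+1.
Proof. by rewrite divr_gt0 ?exprn_gt0. Qed.

Lemma dyadic_ge0 k m : 0 <= dyadic R k m.
Proof. by rewrite divr_ge0 ?exprn_ge0. Qed.

Lemma dyadicD k m n : dyadic R k (m + n) = dyadic R k m + dyadic R k n.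
Proof. by rewrite /dyadic natrD mulrDl. Qed.

Lemma dyadic_scale k j m : dyadic R (k + j) (m * 2 ^ j) = dyadic R k m.
Proof.
by rewrite /dyadic natrM natrX exprD -mulf_div divff ?mulr1// expf_neq0.
Qed.

Lemma dyadic_double k m : dyadic R k.+1 m.*2 = dyadic R k m.
Proof. by rewrite -(dyadic_scale k 1) addn1 muln2. Qed.

Lemma dyadic_lt k m n : (dyadic R k m < dyadic R k n) = (m < n)%N.
Proof. by rewrite ltr_pM2r ?ltr_nat// invr_gt0 exprn_gt0. Qed.

(** Once the mesh [1 / 2 ^ k] is below [s - r], the first of its multiples strictly above [r] is
    still below [s]. *)
Lemma dyadic_dense r s : 0 <= r -> r < s ->
  exists k m, r < dyadic R k m /\ dyadic R k m < s.
Proof.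
move=> r0 rs.
have sr0 : 0 < s - r by rewrite subr_gt0.
have [k hk] : exists k, (s - r)^-1 < 2 ^+ k.
  exists (Num.bound (s - r)^-1); apply: lt_trans (archi_boundP _) _.
    by rewrite invr_ge0 ltW.
  by rewrite -natrX ltr_nat ltn_expl.
have k0 : 0 < 2 ^+ k :> R by rewrite exprn_gt0.
exists k, (Num.truncn (r * 2 ^+ k)).+1; rewrite /dyadic.
have /andP[h1 h2] := truncn_itv (mulr_ge0 r0 (ltW k0)).
rewrite ltr_pdivlMr// h2 ltr_pdivrMr//; split=> //.
rewrite -natr1; apply: le_lt_trans (lerD h1 (lexx 1)) _.
have : 1 < (s - r) * 2 ^+ k by rewrite mulrC -ltr_pdivrMr// div1r.
by rewrite mulrBl ltrBrDl.
Qed.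

End Dyadic.

(** * Gauge of a family of sets indexed by dyadic rationals *)

Section DyadicGauge.
Variables (R : realType) (G : zmodType) (A : nat -> nat -> set G).
Hypothesis AT : A 0 1 = setT.
Hypothesis A_double : forall k m, A k.+1 m.*2 = A k m.
Hypothesis A0 : forall k m, A k m 0.
Hypothesis AN : forall k m x, A k m x -> A k m (- x).
Hypothesis AD : forall k m n x y, A k m x -> A k n y -> A k (m + n) (x + y).

Let A_scale k j m : A (k + j) (m * 2 ^ j) = A k m.
Proof.
elim: j => [|j IH]; first by rewrite addn0 muln1.
by rewrite expnS mulnCA mul2n addnS A_double.
Qed.

Let A_le k m n x : (m <= n)%N -> A k m x -> A k n x.
Proof. by move=> /subnKC <- Ax; rewrite -[x]addr0; exact: AD. Qed.

(** Over the common denominator [2 ^ (k + j)] the comparison is between numerators. *)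
Let A_lt k m j n x : dyadic R k m < dyadic R j n -> A k m x -> A j n x.
Proof.
rewrite -(dyadic_scale R k j) -(dyadic_scale R j k) addnC dyadic_lt => /ltnW mn.
by rewrite -(A_scale k j) -(A_scale j k) addnC; exact: A_le.
Qed.

(** The gauge of [x] is the infimum of the dyadic rationals whose set contains [x]. It need not be
    attained, hence the strict inequality in the second implication. *)
Lemma dyadic_gauge : exists2 rho : G -> R, unit_norm rho &
  forall k m x, (A k m x -> rho x <= dyadic R k m) /\
                (rho x < dyadic R k m -> A k m x).
Proof.
pose V x := [set r : R | exists k m, A k m x /\ r = dyadic R k m].
have V0 x : V x (dyadic R 0 1) by exists 0%N, 1%N; rewrite AT.
have Vlb x : has_lbound (V x).
  by exists 0 => _ [k [m [_ ->]]]; exact: dyadic_ge0.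
have Vne x : V x !=set0 by exists (dyadic R 0 1).
have rhoA k m x : A k m x -> inf (V x) <= dyadic R k m.
  by move=> Ax; apply: ge_inf => //; exists k, m.
have Arho k m x : inf (V x) < dyadic R k m -> A k m x.
  by move=> /(inf_lt (Vne x))[_ [j [n [Ax ->]]] /A_lt]; exact.
exists (fun x => inf (V x)) => [|k m x]; last first.
  by split; [exact: rhoA|exact: Arho].
have rho_ge0 x : 0 <= inf (V x).
  by apply: lb_le_inf => // _ [k [m [_ ->]]]; exact: dyadic_ge0.
split=> [g||g|g h].
- rewrite rho_ge0/= (le_trans (ge_inf (Vlb g) (V0 g)))//.
  by rewrite /dyadic expr0 divr1.
- apply/eqP; rewrite eq_le rho_ge0 andbT.
  by rewrite (le_trans (rhoA 0%N 0%N 0 (A0 _ _)))// /dyadic mul0r.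
- congr (inf _); apply/seteqP; split=> _ [k [m [/AN Ax ->]]]; exists k, m;
    by rewrite ?opprK in Ax *.
(* Near-optimal dyadic rationals for [g] and [h] are added over a common denominator. *)
- apply/ler_addgt0Pr => e e0.
  have e2 : 0 < e / 2 by rewrite divr_gt0.
  have lt_e x : inf (V x) < inf (V x) + e / 2 by rewrite ltrDl.
  have [_ [k [m [Ag ->]]] lt_g] := inf_lt (Vne g) (lt_e g).
  have [_ [j [n [Ah ->]]] lt_h] := inf_lt (Vne h) (lt_e h).
  have Agh : A (k + j) (m * 2 ^ j + n * 2 ^ k) (g + h).
    by apply: AD; [rewrite A_scale|rewrite addnC A_scale].
  apply: le_trans (rhoA _ _ _ Agh) _.
  rewrite dyadicD dyadic_scale addnC dyadic_scale.
  by rewrite (splitr e) addrACA ltW// ltrD.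
Qed.

(** By density, a sublevel set is the intersection of the [A k m] over all larger dyadic rationals.
    These are positive, so the sets of numerator 0 need not belong to [H]. *)
Lemma gauge_hull (H : set (set G)) (rho : G -> R) : hull_structure H ->
  (forall k m, H (A k m.+1)) ->
  (forall k m x, (A k m x -> rho x <= dyadic R k m) /\
                 (rho x < dyadic R k m -> A k m x)) ->
  forall r, 0 <= r -> H [set x | rho x <= r].
Proof.
move=> [_ hullI] HA rhoA r r0.
pose F := [set B | exists k m, B = A k m.+1 /\ r < dyadic R k m.+1].
suff -> : [set x | rho x <= r] = \bigcap_(B in F) B.
  by apply: hullI => _ [k [m [-> _]]].
apply/seteqP; split=> x /=.
  by move=> xr _ [k [m [-> rkm]]]; apply: (rhoA _ _ _).2; exact: le_lt_trans rkm.
move=> Fx; rewrite leNgt; apply/negP => /(dyadic_dense r0)[k [[|m] [h1 h2]]].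
  by move: h1; rewrite /dyadic mul0r ltNge r0.
have /(rhoA _ _ _).1 : A k m.+1 x by apply: Fx; exists k, m.
by rewrite leNgt h2.
Qed.

End DyadicGauge.

(** * Sums of neighbourhoods along binary expansions *)

Section DyadicSum.
Variables (G : zmodType) (U : nat -> set G).
Hypothesis U0 : forall k, U k 0.
Hypothesis UN : forall k x, U k x -> U k (- x).
Hypothesis UD : forall k x y, U k.+1 x -> U k.+1 y -> U k (x + y).

(* The level set for [m / 2^k]: level 0 of the recursion makes it everything
   from 1 on, so that the gauge is bounded by 1. *)
Fixpoint dyadic_sum (k m : nat) : set G :=
  if k is k'.+1 then
    if odd m then [set x + y | x in dyadic_sum k' m./2 & y in U k]
    else dyadic_sum k' m./2
  else if m is 0%N then [set 0] else setT.

Lemma dyadic_sum_double k m : dyadic_sum k.+1 m.*2 = dyadic_sum k m.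
Proof. by rewrite /= odd_double doubleK. Qed.

Lemma dyadic_sumk0 k : dyadic_sum k 0 = [set 0].
Proof. by elim: k. Qed.

Lemma dyadic_sumk1 k : dyadic_sum k.+1 1 = U k.+1.
Proof.
rewrite /= dyadic_sumk0; apply/seteqP; split=> [_ [_ -> [y Uy <-]]|y Uy].
  by rewrite add0r.
by exists 0 => //; exists y => //; rewrite add0r.
Qed.

Lemma dyadic_sum0 k m : dyadic_sum k m 0.
Proof.
elim: k m => [[]//|k IH] m /=; case: ifP => // _.
by exists 0 => //; exists 0; rewrite ?addr0.
Qed.

Lemma dyadic_sumN k m x : dyadic_sum k m x -> dyadic_sum k m (- x).
Proof.
elim: k m x => [[|m] x //= ->|k IH m x /=]; first by rewrite oppr0.
case: ifP => _; last exact: IH.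
by move=> [y /IH Sy [z /UN Uz <-]]; exists (- y) => //; exists (- z);
  rewrite ?opprD.
Qed.

(** This is binary addition: two odd numerators produce a carry, and [UD] turns two summands from
    [U k.+1] into one from [U k]. *)
Lemma dyadic_sumD k m n x y :
  dyadic_sum k m x -> dyadic_sum k n y -> dyadic_sum k (m + n) (x + y).
Proof.
elim: k m n x y => [|k IH] m n x y.
  by case: m n => [|m] [|n]//= -> ->; rewrite addr0.
rewrite /= oddD halfD; case: ifP => om; case: ifP => on /=; rewrite ?add0n.
- move=> [a Sa [b Ub <-]] [c Sc [d Ud <-]].
  rewrite addrACA addnC; apply: (IH); first exact: IH.
  (* For [k = 0] the carry lands in [dyadic_sum 0 1], which is everything. *)
  by case: k {IH Sa Sc} Ub Ud => [//|k] Ub Ud; rewrite dyadic_sumk1; exact: UD.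
- move=> [a Sa [b Ub <-]] Sy; exists (a + y); first exact: IH.
  by exists b => //; rewrite addrAC.
- move=> Sx [c Sc [d Ud <-]]; exists (x + c); first exact: IH.
  by exists d => //; rewrite addrA.
- exact: IH.
Qed.

Lemma dyadic_sum_hull (H : set (set G)) : H setT -> additive_hull H ->
  (forall k, H (U k)) -> forall k m, H (dyadic_sum k m.+1).
Proof.
move=> HT HD HU; elim=> [//|k IH] m.
(* Numerator 1 is treated apart: its half is 0, and [[set 0]] need not lie in [H]. *)
case: m => [|m]; first by rewrite dyadic_sumk1.
have := IH m./2; rewrite -[m./2.+1]/(m.+2./2) => IHm.
have -> : dyadic_sum k.+1 m.+2 =
    if odd m.+2 then [set x + y | x in dyadic_sum k m.+2./2 & y in U k.+1]
    else dyadic_sum k m.+2./2 by [].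
by case: ifP => _ //; exact: HD.
Qed.

End DyadicSum.

Lemma gauge_of_nbhs (R : realType) (G : zmodType) (U : nat -> set G) :
  (forall k, U k 0) -> (forall k x, U k x -> U k (- x)) ->
  (forall k x y, U k.+1 x -> U k.+1 y -> U k (x + y)) ->
  exists2 rho : G -> R, unit_norm rho &
    (forall k m x, (dyadic_sum U k m x -> rho x <= dyadic R k m) /\
                   (rho x < dyadic R k m -> dyadic_sum U k m x)).
Proof.
move=> U0 UN UD; apply: dyadic_gauge => //.
- by move=> k m; exact: dyadic_sum_double.
- exact: dyadic_sum0.
- exact: dyadic_sumN.
- exact: dyadic_sumD.
Qed.

(** * Hull structures and cores *)

Lemma hull_structureI (X : Type) (H : set (set X)) (A B : set X) :
  hull_structure H -> H A -> H B -> H (A `&` B).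
Proof.
move=> [_ hullI] HA HB; have -> : A `&` B = \bigcap_(C in [set A; B]) C.
  apply/seteqP; split=> [x [Ax Bx] _ [->|->]//|x ABx].
  by split; apply: ABx; [left|right].
by apply: hullI => _ [->|->].
Qed.

Lemma hull_structure_setI (X : Type) (H K : set (set X)) :
  hull_structure H -> hull_structure K -> hull_structure (H `&` K).
Proof.
move=> [HT HI] [KT KI]; split=> // F FHK.
by split; [apply: HI|apply: KI] => A /FHK[].
Qed.

Lemma core_sub (X : Type) (P : set (set X)) (A : set X) : core P A `<=` A.
Proof. by move=> x [B [_]]; exact. Qed.

Lemma core_in (X : Type) (P : set (set X)) (A : set X) :
  algebraic1 P -> P (core P A).
Proof. by move=> [_]; apply => B []. Qed.

Lemma core_coreN (G : zmodType) (P : set (set G)) (A : set G) x :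
  symmetric_hull P -> (forall y, A y -> A (- y)) ->
  core P A x -> core P A (- x).
Proof.
move=> symP AN [B [PB BA] Bx]; exists [set - y | y in B]; last by exists x.
by split; [exact: symP|move=> _ [y /BA/AN Ay <-]].
Qed.

Lemma core_coreD (G : zmodType) (P : set (set G)) (A B C : set G) x y :
  additive_hull P -> (forall u v, A u -> B v -> C (u + v)) ->
  core P A x -> core P B y -> core P C (x + y).
Proof.
move=> addP ABC [D [PD DA] Dx] [E [PE EB] Ey].
exists [set u + v | u in D & v in E]; last by exists x => //; exists y.
split; first exact: addP.
by move=> _ [u Du [v Ev <-]]; apply: ABC; [exact: DA|exact: EB].
Qed.

(** * Norms with sublevel sets in both hull structures *)

Section HullNorms.
Variables (R : realType) (G : topologicalZmodType) (Q P : set (set G)).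

Lemma nbhs0N (V : set G) : nbhs (0 : G) V -> nbhs (0 : G) [set x | V (- x)].
Proof. by move=> V0; apply: opp_continuous; rewrite /= oppr0. Qed.

Lemma nbhs0D (V : set G) : nbhs (0 : G) V ->
  exists2 W, nbhs (0 : G) W & forall x y, W x -> W y -> V (x + y).
Proof.
move=> V0; have : nbhs ((0 : G) + 0) V by rewrite addr0.
move=> /(add_continuous ((0 : G), (0 : G)))[[A B] /= [A0 B0] AB].
exists (A `&` B); first exact: filterI.
by move=> x y [Ax _] [_ By]; exact: (AB (x, y)).
Qed.

Lemma nbhs0_shift (V : set G) (g : G) :
  nbhs g V <-> nbhs (0 : G) [set x | V (x + g)].
Proof.
split=> [Vg|V0].
- have : nbhs ((0 : G) + g) V by rewrite add0r.
  move=> /(add_continuous ((0 : G), g))[[A B] /= [A0 B0] AB].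
  by apply: filterS A0 => x Ax; apply: (AB (x, g)); split=> //; exact: nbhs_singleton.
- have : nbhs (g + - g) [set x | V (x + g)] by rewrite subrr.
  move=> /(add_continuous (g, - g))[[A B] /= [A0 B0] AB].
  apply: filterS A0 => x Ax.
  have /= := AB (x, - g); rewrite subrK; apply; split=> //; exact: nbhs_singleton.
Qed.

(** Smallness near 0 is all the continuity asked for: subadditivity and symmetry spread it to every
    point. *)
Definition hull_norm (rho : G -> R) : Prop :=
  [/\ unit_norm rho, forall e, 0 < e -> nbhs (0 : G) [set x | rho x < e] &
      forall r, 0 <= r -> (Q `&` P) [set x | rho x <= r]].

Hypotheses (hullQ : hull_structure Q) (hullP : hull_structure P).
Hypotheses (symQ : symmetric_hull Q) (symP : symmetric_hull P).
Hypotheses (basicP : basic_hull P) (enhQ : enhancible P Q).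
Hypotheses (topQ : hull_topology Q) (topP : hull_topology P).

Lemma hull_topologyP (H : set (set G)) (V : set G) : hull_topology H ->
  nbhs (0 : G) V -> exists B, [/\ nbhs (0 : G) B, H B & B `<=` V].
Proof. by move=> topH; rewrite {1}topH => -[B [B0 HB] BV]; exists B. Qed.

Lemma nbhs0_core (V : set G) : nbhs (0 : G) V -> nbhs (0 : G) (core P V).
Proof.
move=> /(hull_topologyP topP)[B [B0 PB BV]].
by apply: filterS B0 => x Bx; exists B.
Qed.

Lemma core_setI_hull (V : set G) : Q V -> V 0 -> (Q `&` P) (core P V).
Proof.
move=> QV V0; split; first exact: (enhQ QV V0).2.
by apply: core_in; case: basicP.
Qed.

Lemma preimage_hullN (H : set (set G)) (V : set G) : symmetric_hull H ->
  H V -> H [set x | V (- x)].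
Proof.
move=> symH /symH; congr H; apply/seteqP; split=> [_ [x Vx <-]|x Vx] /=.
  by rewrite opprK.
by exists (- x); rewrite ?opprK.
Qed.

(** The core of a neighbourhood in [Q] lies in [Q] by enhancibility, in [P] by 1-algebraicity, and
    is a neighbourhood by [nbhs0_core]; intersecting it with its negative makes it symmetric. *)
Lemma nbhs0_sum_sub (V : set G) : nbhs (0 : G) V ->
  exists W, [/\ nbhs (0 : G) W, (Q `&` P) W, forall x, W x -> W (- x) &
                forall x y, W x -> W y -> V (x + y)].
Proof.
move=> /nbhs0D[V' V'0 V'V].
have [B [B0 QB BV']] := hull_topologyP topQ V'0.
have C0 := nbhs0_core B0.
have QPC : (Q `&` P) (core P B).
  by apply: core_setI_hull => //; exact: nbhs_singleton.
exists (core P B `&` [set x | core P B (- x)]); split.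
- by apply: filterI => //; exact: nbhs0N.
- apply: hull_structureI => //; first exact: (hull_structure_setI hullQ hullP).
  by case: QPC => QC PC; split; exact: preimage_hullN.
- by move=> x [Cx CNx] /=; rewrite opprK.
- by move=> x y [Cx _] [Cy _]; apply: V'V; apply: BV'; exact: (@core_sub _ P B).
Qed.

Lemma nbhs0_chain (V : set G) : nbhs (0 : G) V ->
  exists U : nat -> set G,
  [/\ forall k, nbhs (0 : G) (U k), forall k, (Q `&` P) (U k),
      forall k x, U k x -> U k (- x),
      forall k x y, U k.+1 x -> U k.+1 y -> U k (x + y) & U 0%N `<=` V].
Proof.
move=> V0.
have /choice[h hP] : forall V : set G, exists W, nbhs (0 : G) V ->
  [/\ nbhs (0 : G) W, (Q `&` P) W, forall x, W x -> W (- x) &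
      forall x y, W x -> W y -> V (x + y)].
  move=> V'; have [/nbhs0_sum_sub[W ?]|] := pselect (nbhs (0 : G) V').
    by exists W.
  by exists setT.
have iter0 k : nbhs (0 : G) (iter k h V) by elim: k => // k /hP[].
(* The chain starts at the first iterate, since [V] itself need be neither symmetric nor in the
   hulls. *)
exists (fun k => iter k.+1 h V); split=> [k|k|k x|k x y|x hx].
- exact: iter0.
- by case: (hP _ (iter0 k)).
- by case: (hP _ (iter0 k)) => _ _ hN _; exact: hN.
- by case: (hP _ (iter0 k.+1)) => _ _ _ hD; exact: hD.
- have [h0 _ _ hD] := hP _ V0; rewrite -[x]addr0; apply: hD => //.
  exact: nbhs_singleton.
Qed.

(** A positive dyadic rational [m / 2 ^ k] below [e] is at least [1 / 2 ^ k.+1], whose level set is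
    the neighbourhood [U k.+1]. *)
Lemma gauge_nbhs0 (U : nat -> set G) (rho : G -> R) :
  (forall k, nbhs (0 : G) (U k)) ->
  (forall k m x, dyadic_sum U k m x -> rho x <= dyadic R k m) ->
  forall e, 0 < e -> nbhs (0 : G) [set x | rho x < e].
Proof.
move=> U0 rhoU e e0; have [k [m [lt0 lte]]] := dyadic_dense (lexx 0) e0.
apply: filterS (U0 k.+1) => x Ux /=; apply: le_lt_trans lte.
apply: le_trans (rhoU k.+1 1%N x _) _; first by rewrite dyadic_sumk1.
rewrite -(dyadic_double R k m); case: m lt0 => [|m _].
  by rewrite /dyadic mul0r ltxx.
by rewrite /dyadic ler_pM2r ?ler_nat// invr_gt0 exprn_gt0.
Qed.

Lemma additive_hull_norm (V : set G) : additive_hull Q -> nbhs (0 : G) V ->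
  exists2 rho, hull_norm rho & exists2 e, 0 < e & forall x, rho x < e -> V x.
Proof.
move=> addQ /nbhs0_chain[U [U0 QPU UN UD UV]].
have U00 k : U k 0 by exact: nbhs_singleton.
have [rho norm_rho rhoU] := gauge_of_nbhs R U00 UN UD.
exists rho; [split=> //|].
- by apply: gauge_nbhs0 U0 _ => k m x; exact: (rhoU k m x).1.
- apply: gauge_hull rhoU; first exact: hull_structure_setI.
  apply: dyadic_sum_hull => //; first by split; [case: hullQ|case: hullP].
  move=> A B [QA PA] [QB PB]; split; first exact: addQ.
  by case: basicP => _ addP _; exact: addP.
(* The level set of 1/2 is [U 1], contained in [U 0]; that of 1 would be everything. *)
- exists (dyadic R 1 1); first exact: dyadic_gt0.
  move=> x /(rhoU _ _ _).2; rewrite dyadic_sumk1 => Ux.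
  by apply: UV; rewrite -[x]addr0; exact: UD.
Qed.

(** Sums of members of [Q] may leave [Q], so [rho] only serves to measure distances; [dyadic_gauge]
    is applied a second time, to the cores of the sets [T r], and yields the norm [sigma]. *)
Lemma translation_invariant_hull_norm (V : set G) :
  translation_invariant_hull Q -> nbhs (0 : G) V ->
  exists2 rho, hull_norm rho & exists2 e, 0 < e & forall x, rho x < e -> V x.
Proof.
move=> trQ V0; have [B [B0 QB BV]] := hull_topologyP topQ V0.
have [U [U0 QPU UN UD UB]] := nbhs0_chain B0.
have U00 k : U k 0 by exact: nbhs_singleton.
have [rho [rho01 rho0 rhoN rhoD] rhoU] := gauge_of_nbhs R U00 UN UD.
have rho_ge0 x : 0 <= rho x by case/andP: (rho01 x).
have rhoB x : rho x < 2^-1 -> B x.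
  move=> rx; apply: UB; rewrite -[x]addr0; apply: UD => //.
  rewrite -(dyadic_sumk1 U); apply: (rhoU _ _ _).2.
  by rewrite /dyadic expr1 div1r.
(* With [D] as in the header, [E t = {D >= t}] for [t <= 1], and
   [S r = {x | forall y, D y - r <= D (x + y)}]. *)
pose E (t : R) := [set y | forall u, rho u < t -> B (y + u)].
pose S (r : R) := [set x | forall t y, t <= 1 -> E t y -> E (t - r) (x + y)].
(* Nonnegativity of [s] keeps [t - s] at most 1, where [Sx] applies. *)
have SD r s x y : 0 <= s -> S r x -> S s y -> S (r + s) (x + y).
  move=> s0 Sx Sy t z t1 Ez; rewrite -addrA.
  have -> : t - (r + s) = t - s - r by ring.
  by apply: Sx; [rewrite lerBlDr (le_trans t1)// lerDl|exact: Sy].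
have S0 r : 0 <= r -> S r 0.
  move=> r0 t y _ Ey u ut; rewrite add0r; apply: Ey.
  by rewrite (lt_le_trans ut)// lerBlDr lerDl.
(* The function [D] is 1-Lipschitz for [rho]. *)
have SE r x : rho x <= r -> S r x.
  move=> xr t y _ Ey u ut; rewrite (addrC x) -addrA; apply: Ey.
  by rewrite (le_lt_trans (rhoD _ _))// addrC -ltrBrDr (lt_le_trans ut)// lerD2l lerN2.
have QS r : 0 <= r -> Q (S r).
  move=> r0.
  (* For fixed [t], [y] and [u] the condition on [x] is [B (y + u + x)], that is, membership in a
     translate of [B]. *)
  pose F := [set C | exists z, C = (fun g => z + g) @^-1` B /\
    exists t y u, [/\ t <= 1, E t y, rho u < t - r & z = y + u]].
  suff -> : S r = \bigcap_(C in F) C.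
    by case: hullQ => _; apply=> _ [z [-> _]]; exact: trQ.
  apply/seteqP; split=> [x Sx _ [_ [-> [t [y [u [t1 Ey ut ->]]]]]]|x Fx t y t1 Ey u ut].
    by rewrite /= addrC addrA; exact: Sx ut.
  rewrite -addrA addrC.
  by apply: (Fx ((fun g => (y + u) + g) @^-1` B)); exists (y + u); split=> //;
    exists t, y, u.
pose T r := S r `&` [set x | S r (- x)].
have QT r : 0 <= r -> Q (T r).
  move=> r0; apply: hull_structureI => //; first exact: QS.
  by apply: preimage_hullN => //; exact: QS.
have TD r s x y : 0 <= r -> 0 <= s -> T r x -> T s y -> T (r + s) (x + y).
  by move=> r0 s0 [Sx SNx] [Sy SNy]; split; [|rewrite /= opprD]; exact: SD.
have T0 r : 0 <= r -> T r 0 by move=> r0; split; rewrite /= ?oppr0; exact: S0.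
have TN r x : T r x -> T r (- x) by case=> Sx SNx; split; rewrite /= ?opprK.
(* The bound [t <= 1] enters here: [rho u < t - 1] is impossible. *)
have T1 : T 1 = setT.
  have S1 x : S 1 x.
    move=> t y t1 _ u.
    by rewrite ltNge (le_trans _ (rho_ge0 u))// subr_le0.
  by apply/seteqP; split=> // x _; split; exact: S1.
(* By [rhoB], [D 0] is at least 1/2, so [D x] is at least 1/4 and taking [u = 0] gives [B x]. *)
have TV x : T 4^-1 x -> B x.
  move=> [Sx _].
  have E2 : E 2^-1 0 by move=> u; rewrite add0r; exact: rhoB.
  have := Sx 2^-1 0 _ E2 0; rewrite !addr0 rho0; apply; lra.
pose A k m := core P (T (dyadic R k m)).
have dge0 k m : 0 <= dyadic R k m by exact: dyadic_ge0.
have QPA k m : (Q `&` P) (A k m) by apply: core_setI_hull; [exact: QT|exact: T0].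
have PT : P setT by case: hullP.
have [sigma norm_sigma sigmaA] : exists2 sigma : G -> R, unit_norm sigma &
    forall k m x, (A k m x -> sigma x <= dyadic R k m) /\
                  (sigma x < dyadic R k m -> A k m x).
  apply: dyadic_gauge.
  - by rewrite /A /dyadic expr0 divr1 T1; apply/seteqP; split=> // x _; exists setT.
  - by move=> k m; rewrite /A dyadic_double.
  - by move=> k m; exact: (enhQ (QT _ (dge0 k m)) (T0 _ (dge0 k m))).1.
  - by move=> k m x; exact: core_coreN symP (TN _).
  - move=> k m n x y; rewrite /A dyadicD; apply: core_coreD.
      by case: basicP.
    by move=> u v; exact: TD.
exists sigma; [split=> //|].
- move=> e e0; have [k [m [lt0 lte]]] := dyadic_dense (lexx 0) e0.
  (* A [rho]-ball lies in the set [T (dyadic R k m)] by [SE], so that set is a neighbourhood, and so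
     is its core. *)
  have A_nbhs : nbhs (0 : G) (A k m).
    apply: nbhs0_core; apply: filterS (gauge_nbhs0 U0 (fun k m x => (rhoU k m x).1) lt0).
    by move=> x /= /ltW xr; split; apply: SE; rewrite ?rhoN.
  by apply: filterS A_nbhs => x /(sigmaA _ _ _).1 /le_lt_trans; exact.
- by apply: gauge_hull sigmaA => //; exact: (hull_structure_setI hullQ hullP).
- exists (dyadic R 2 1); first exact: dyadic_gt0.
  move=> x /(sigmaA _ _ _).2 Ax; apply: BV; apply: TV.
  have -> : 4^-1 = dyadic R 2 1 by rewrite /dyadic div1r -natrX.
  exact: (@core_sub _ P).
Qed.

Lemma exists_hull_norm (V : set G) :
  additive_hull Q \/ translation_invariant_hull Q -> nbhs (0 : G) V ->
  exists2 rho, hull_norm rho & exists2 e, 0 < e & forall x, rho x < e -> V x.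
Proof.
by case; [exact: additive_hull_norm|exact: translation_invariant_hull_norm].
Qed.

(** Capping [rho n] at [1 / (n + 1)] makes all but finitely many terms uniformly small, which keeps
    the supremum continuous at 0; below the cap it still dominates [rho n]. *)
Lemma countable_hull_norm (V : nat -> set G) :
  additive_hull Q \/ translation_invariant_hull Q ->
  (forall n, nbhs (0 : G) (V n)) ->
  exists2 rho, hull_norm rho &
    forall n, exists2 e, 0 < e & forall x, rho x < e -> V n x.
Proof.
move=> addtrQ V0.
have /choice[rho rhoP] n : exists rho, hull_norm rho /\
    exists2 e, 0 < e & forall x, rho x < e -> V n x.
  by have [rho ? ?] := exists_hull_norm addtrQ (V0 n); exists rho.
pose c n : R := n.+1%:R^-1.
have c_gt0 n : 0 < c n by rewrite invr_gt0.
have c_le1 n : c n <= 1 by rewrite invf_le1// ler1n.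
pose E x := range (fun n => Num.min (rho n x) (c n)).
have Ene x : E x !=set0 by exists (Num.min (rho 0%N x) (c 0%N)); exists 0%N.
have Eub x : has_ubound (E x).
  by exists 1 => _ [n _ <-]; rewrite ge_min c_le1 orbT.
pose sigma x := sup (E x).
have sigma_ge n x : Num.min (rho n x) (c n) <= sigma x.
  by apply: ub_le_sup => //; exists n.
have sigma_le r x : (forall n, Num.min (rho n x) (c n) <= r) -> sigma x <= r.
  by move=> le_r; apply: ge_sup => // _ [n _ <-].
have rho_ge0 n x : 0 <= rho n x.
  by have [[+ _ _ _] _ _] := (rhoP n).1; move=> /(_ x)/andP[].
have sigma_ge0 x : 0 <= sigma x.
  by apply: le_trans (sigma_ge 0%N x); rewrite le_min rho_ge0 ltW.
exists sigma; [split|].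
- split=> [x||x|x y].
  + by rewrite sigma_ge0 sigma_le// => n; rewrite ge_min c_le1 orbT.
  + apply/eqP; rewrite eq_le sigma_ge0 andbT; apply: sigma_le => n.
    by have [[_ -> _ _] _ _] := (rhoP n).1; rewrite ge_min lexx.
  + congr (sup _); apply/seteqP; split=> _ [n _ <-]; exists n => //;
      by have [[_ _ -> _] _ _] := (rhoP n).1.
  (* Truncation from above preserves subadditivity because the values are nonnegative. *)
  + apply: sigma_le => n; have [[_ _ _ /(_ x y) rhoD] _ _] := (rhoP n).1.
    apply: le_trans (lerD (sigma_ge n x) (sigma_ge n y)).
    have := rho_ge0 n x; have := rho_ge0 n y; have := c_gt0 n.
    by rewrite /Num.min; do !case: ifPn; rewrite -?leNgt; lra.
- move=> e e0; have e2 : 0 < e / 2 by rewrite divr_gt0.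
  (* From [N] on the caps are below [e / 2], so only finitely many [rho n] have to be made small. *)
  have [N _ cN] := near_infty_natSinv_lt (PosNum e2).
  have : nbhs (0 : G) [set x | forall n : 'I_N, rho n x < e / 2].
    by apply: filter_forall => n; have [_ + _] := (rhoP n).1; exact.
  apply: filterS => x /= rho_lt; apply: le_lt_trans (_ : e / 2 < e); last first.
    by rewrite ltr_pdivrMr// mulr_natr mulr2n ltrDl.
  apply: sigma_le => n; rewrite ge_min; have [nN|Nn] := ltnP n N.
    by rewrite (ltW (rho_lt (Ordinal nN))).
  by rewrite orbC ltW//; exact: cN.
- move=> r r0.
  pose F := [set A | exists n,
    A = [set x | Num.min (rho n x) (c n) <= r]].
  suff -> : [set x | sigma x <= r] = \bigcap_(A in F) A.
    have [HT HI] := hull_structure_setI hullQ hullP.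
    (* A cap at most [r] makes the condition vacuous; otherwise it defines the sublevel set of
       [rho n]. *)
    apply: HI => _ [n ->]; have [cr|rc] := leP (c n) r.
      by rewrite (_ : mkset _ = setT)//; apply/seteqP; split=> // x _ /=;
        rewrite ge_min cr orbT.
    have [_ _ /(_ r r0)] := (rhoP n).1; congr ((Q `&` P) _).
    by apply/seteqP; split=> x /=; rewrite ge_min [c n <= r]leNgt rc orbF.
  apply/seteqP; split=> [x xr _ [n ->]|x Fx].
    exact: le_trans (sigma_ge n x) xr.
  by apply: sigma_le => n; apply: (Fx [set x | Num.min (rho n x) (c n) <= r]); exists n.
- move=> n; have [_ [e e0 eV]] := rhoP n.
  exists (Num.min e (c n)); first by rewrite lt_min e0 c_gt0.
  move=> x; rewrite lt_min => /andP[xe xc]; apply: eV.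
  have := le_lt_trans (sigma_ge n x) xe; rewrite gt_min => /orP[//|ce].
  by have := le_lt_trans (sigma_ge n x) xc; rewrite gt_min ltxx orbF => /lt_trans; apply.
Qed.

End HullNorms.

(** * Extended-valued pseudo-norms and their topologies *)

Lemma pseudo_norm_cvg (R : realType) (G : zmodType) (F : set_system G)
    (lambda : G -> \bar R) (g : G) : Filter F -> pseudo_norm lambda ->
  (forall e, 0 < e -> \forall h \near F,
     (lambda (h - g)%R < e%:E)%E /\ (lambda (g - h)%R < e%:E)%E) ->
  lambda h @[h --> F] --> lambda g.
Proof.
move=> FF [l_ge0 l0 lD] near_g.
(* As [lambda] need not be symmetric, its values at [h - g] and [g - h] bound the difference from
   the two sides. *)
have lDg h : (lambda h <= lambda (h - g)%R + lambda g)%E.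
  by have := lD (h - g) g; rewrite subrK.
have lDh h : (lambda g <= lambda (g - h)%R + lambda h)%E.
  by have := lD (g - h) h; rewrite subrK.
case lg : (lambda g) (l_ge0 g) => [r| |//] _.
- have lh_fin h : (lambda (h - g)%R < 1%:E)%E -> lambda h \is a fin_num.
    move=> l1; rewrite ge0_fin_numE//; apply: le_lt_trans (lDg h) _.
    by rewrite lg lte_add_pinfty ?ltry// (lt_trans l1) ?ltry.
  apply/fine_cvgP; split.
    by apply: filterS (near_g 1 ltr01) => h [/lh_fin].
  apply/cvgrPdist_lt => e e0.
  (* The cap 1 makes [lambda h] finite through [lh_fin]. *)
  have me0 : 0 < Num.min e 1 by rewrite lt_min e0 ltr01.
  apply: filterS (near_g _ me0) => h [].
  have [d1|] := boolP (lambda (h - g)%R \is a fin_num); last first.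
    by rewrite ge0_fin_numE// -leNgt leye_eq => /eqP ->.
  have [d2|] := boolP (lambda (g - h)%R \is a fin_num); last first.
    by rewrite ge0_fin_numE// -leNgt leye_eq => /eqP -> _.
  rewrite -(fineK d1) -(fineK d2) !lte_fin !lt_min => /andP[hg hg1] /andP[gh _].
  have lh : lambda h \is a fin_num by apply: lh_fin; rewrite -(fineK d1) lte_fin.
  have := lDg h; have := lDh h.
  rewrite lg -(fineK d1) -(fineK d2) -(fineK lh) -!EFinD !lee_fin /= ltr_norml.
  lra.
(* If [lambda g] is infinite, so is [lambda h] whenever [lambda (g - h)] is finite. *)
- apply/cvgeyPge => A; apply: filterS (near_g 1 ltr01) => h [_ l1].
  have : (+oo <= lambda (g - h)%R + lambda h)%E by rewrite -lg.
  rewrite leye_eq; case: (lambda h) => [s| |]; [|by rewrite leey|].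
    by case: (lambda (g - h)%R) l1.
  by case: (lambda (g - h)%R) l1.
Qed.

Section EFinNorm.
Variables (R : realType) (G : topologicalZmodType) (Q P : set (set G)).
Variable rho : G -> R.
Hypothesis rhoP : hull_norm Q P rho.

Lemma EFin_pseudo_norm : pseudo_norm (EFin \o rho).
Proof.
case: rhoP => -[rho01 rho0 rhoN rhoD] _ _; split=> [g||g h] /=.
- by rewrite lee_fin; case/andP: (rho01 g).
- by rewrite rho0.
- by rewrite -EFinD lee_fin.
Qed.

Lemma EFin_hull_norm :
  [/\ hull_pseudo_norm (Q `&` P) (EFin \o rho), symmetric_fun (EFin \o rho),
      continuous (EFin \o rho) & unit_valued (EFin \o rho)].
Proof.
case: rhoP => -[rho01 rho0 rhoN rhoD] rho_nbhs rhoQP; split.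
- split; first exact: EFin_pseudo_norm.
  move=> r r0; rewrite (_ : _ @^-1` _ = [set x | rho x <= r]); first exact: rhoQP.
  apply/seteqP; split=> x /=; rewrite in_itv/= !lee_fin; first by case/andP.
  by move=> ->; case/andP: (rho01 x) => ->.
- by move=> g /=; rewrite rhoN.
- move=> g; apply: pseudo_norm_cvg; first exact: EFin_pseudo_norm.
  move=> e e0; apply/nbhs0_shift; apply: filterS (rho_nbhs e e0) => x /= xe.
  by rewrite addrK opprD addrCA subrr addr0 rhoN !lte_fin.
- by move=> g; rewrite /= !lee_fin.
Qed.

(** Subadditivity makes balls open, so they form neighbourhood bases; symmetry exchanges the [g - h]
    of [pnorm_open] for [h - g]. *)
Lemma nbhs_pnorm_space (g : G) (A : set G) :
  nbhs (g : pnorm_space (EFin \o rho)) A <->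
  exists2 e, 0 < e & forall h, rho (h - g) < e -> A h.
Proof.
case: rhoP => -[rho01 rho0 rhoN rhoD] _ _; rewrite nbhsE; split.
- move=> [B [oB Bg] BA]; have [e e0 eB] := oB g Bg.
  by exists e => // h he; apply: BA; apply: eB; rewrite /= lte_fin -rhoN opprB.
- move=> [e e0 eA]; exists [set h | rho (h - g) < e] => //.
  split; last by rewrite /= subrr rho0.
  move=> h /= hg; exists (e - rho (h - g)); first by rewrite subr_gt0.
  move=> k; rewrite /= lte_fin -rhoN opprB ltrBrDr => kh; apply: le_lt_trans kh.
  by have := rhoD (k - h) (h - g); rewrite addrA subrK.
Qed.

End EFinNorm.

(** * The five clauses *)

Lemma exists_natSinv_lt (R : realType) (e : R) : 0 < e ->
  exists n, n.+1%:R^-1 < e.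
Proof.
move=> e0; have [N _ NP] := near_infty_natSinv_lt (PosNum e0).
by exists N; apply: NP => /=.
Qed.

(** Addition is continuous at [(g, - g)]; freezing the second argument at [- g] carries
    neighbourhoods of 0 to neighbourhoods of [g]. *)
Lemma additive_topology_shift (G : zmodType) (s : Topological G)
    (V : set G) (g : G) : additive_topology s ->
  nbhs ((0 : G) : Topological.Pack s) V ->
  nbhs (g : Topological.Pack s) [set h | V (h - g)].
Proof.
move=> adds V0; have := adds ((g : Topological.Pack s), (- g : G)) V.
rewrite /= subrr => /(_ V0)[[A B] /= [Ag Bg] AB].
apply: filterS Ag => h Ah; apply: (AB (h, - g)); split=> //=.
exact: (@nbhs_singleton (Topological.Pack s)).
Qed.

Theorem theorem4p5 (R : realType) (G : topologicalZmodType)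
    (Q P : set (set G))
    (hullQ : hull_structure Q) (hullP : hull_structure P)
    (symQ : symmetric_hull Q) (symP : symmetric_hull P)
    (basicP : basic_hull P) (enhQ : enhancible P Q)
    (addtrQ : additive_hull Q \/ translation_invariant_hull Q)
    (topQ : hull_topology Q) (topP : hull_topology P) :
  [/\ (exists N : set (G -> \bar R),
        (forall rho, N rho ->
          [/\ hull_pseudo_norm (Q `&` P) rho, symmetric_fun rho,
              continuous rho & unit_valued rho]) /\
        generated_topology N (Topological.class G)),
      ((exists2 B : set (set G), countable B & filter_base (nbhs (0 : G)) B) ->
        exists rho : G -> \bar R,
          [/\ hull_pseudo_norm (Q `&` P) rho, symmetric_fun rho,
              continuous rho, unit_valued rho &
              same_topology (Topological.class G) (pnorm_topology rho)]),
      (forall f : G -> R, f 0 = 0 -> continuous_at (0 : G) f ->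
        exists rho : G -> \bar R,
          [/\ hull_pseudo_norm (Q `&` P) rho, symmetric_fun rho,
              continuous rho,
              continuous_at ((0 : G) : pnorm_space rho)
                            (f : pnorm_space rho -> R) &
              rho @^-1` [set 0%E] `<=` f @^-1` [set 0]]),
      (submetrizable_topology R (Topological.class G) ->
        exists rho : G -> \bar R,
          [/\ hull_pseudo_norm (Q `&` P) rho, symmetric_fun rho,
              continuous rho & rho @^-1` [set 0%E] = [set 0]]) &
      (forall lambda : G -> \bar R, pseudo_norm lambda -> continuous lambda ->
        exists rho : G -> \bar R,
          [/\ hull_pseudo_norm (Q `&` P) rho, symmetric_fun rho,
              continuous rho, unit_valued rho &
              continuous (lambda : pnorm_space rho -> \bar R)])].
Proof.
have countable_norm (V : nat -> set G) : (forall n, nbhs (0 : G) (V n)) ->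
    exists2 rho : G -> R, hull_norm Q P rho &
      forall n, exists2 e, 0 < e & forall x, rho x < e -> V n x.
  by move=> V0; exact: countable_hull_norm.
have norm0 (rho : G -> R) : hull_norm Q P rho -> rho 0 = 0 by case=> -[].
have rho_ker (rho : G -> R) x (V : nat -> set G) : (EFin \o rho) x = 0%E ->
    (forall n, exists2 e, 0 < e & forall x, rho x < e -> V n x) ->
    forall n, V n x.
  by move=> [rx] rhoV n; have [e e0] := rhoV n; apply; rewrite rx.
split.
- exists [set rho | exists2 sigma, hull_norm Q P sigma & rho = EFin \o sigma].
  split=> [_ [sigma sigmaP ->]|]; first exact: EFin_hull_norm.
  split.
  + exact: add_continuous.
  + by move=> _ [sigma /EFin_hull_norm[_ _ cts _] ->]; exact: cts.
  (* An open set shifted to 0 contains a [rho]-ball, which is an [s]-neighbourhood of 0 by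
     continuity and is then shifted back to [g]. *)
  + move=> s adds conts A; rewrite !openE => oA g Ag.
    have /nbhs0_shift A0 : nbhs (g : G) A by exact: oA.
    have [rho rhoP [e e0 eA]] := exists_hull_norm R hullQ hullP symQ symP
      basicP enhQ topQ topP addtrQ A0.
    have re : nbhs ((EFin \o rho) 0) [set y | (y < e%:E)%E].
      apply: open_nbhs_nbhs; split; last by rewrite /= (norm0 rho) ?lte_fin.
      exact: open_ereal_lt_ereal.
    have /(_ _ re) s0 := conts (EFin \o rho) (ex_intro2 _ _ rho rhoP erefl).
    apply: filterS (additive_topology_shift g adds s0) => h /=.
    by rewrite lte_fin => /eA; rewrite /= subrK.
(* A countable base is empty or enumerated by some [b]; it is not empty, since [setT] must contain a
   member. *)
- move=> [B /pfcard_geP[B0|[b]]].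
    rewrite B0 => base0; have : nbhs (0 : G) setT by exact: filterT.
    by rewrite base0 => -[].
  move=> base0; have Bnbhs V : B V -> nbhs (0 : G) V by rewrite base0; exists V.
  have [rho rhoP rhob] := countable_norm b (fun n => Bnbhs _ (@funS _ _ _ _ b n I)).
  exists (EFin \o rho); have [H1 H2 cts H4] := EFin_hull_norm rhoP; split=> //.
  split=> A.
  + rewrite /= !openE => oA g Ag; apply/(nbhs_pnorm_space rhoP).
    have /nbhs0_shift : nbhs (g : G) A by exact: oA.
    rewrite base0 => -[C BC CA].
    have [n _ bn] : (b @` setT) C by exact: surj.
    have [e e0 eb] := rhob n.
    exists e => // h /eb; rewrite bn => /CA; by rewrite /= subrK.
  + move=> oA; rewrite /= openE => g Ag.
    have /(nbhs_pnorm_space rhoP)[e e0 eA] : nbhs (g : pnorm_space (EFin \o rho)) A.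
      by apply: open_nbhs_nbhs; split.
    apply/nbhs0_shift; case: rhoP => _ /(_ e e0) + _; apply: filterS => h he /=.
    by apply: eA; rewrite addrK.
(* Controlling all [V n] by one norm gives continuity at 0 and, on intersecting them, the inclusion
   of kernels. *)
- move=> f f0 cf; pose V n := [set x | `|f x| < n.+1%:R^-1].
  have V0 n : nbhs (0 : G) (V n).
    have n0 : 0 < n.+1%:R^-1 :> R by rewrite invr_gt0.
    have /cvgrPdist_lt/(_ _ n0) := cf; apply: filterS => x.
    by rewrite /= f0 sub0r normrN.
  have [rho rhoP rhoV] := countable_norm V V0.
  exists (EFin \o rho); have [H1 H2 cts H4] := EFin_hull_norm rhoP; split=> //.
  + have FF := nbhs_filter ((0 : G) : pnorm_space (EFin \o rho)).
    apply/(@cvgrPdist_lt _ _ _ _ FF) => e e0; have [n ne] := exists_natSinv_lt e0.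
    apply/(nbhs_pnorm_space rhoP); have [d d0 dV] := rhoV n; exists d => // h.
    rewrite subr0 => /dV Vh /=; rewrite f0 sub0r normrN.
    exact: lt_trans Vh ne.
  + move=> x rx /=; have Vx := rho_ker _ _ _ rx rhoV; apply/eqP; rewrite -normr_le0 leNgt.
    apply/negP => /exists_natSinv_lt[n /lt_trans /(_ (Vx n))].
    by rewrite ltxx.
(* Metric balls around 0 are neighbourhoods in [G]; a point where [rho] vanishes lies in all the
   [V n], hence is at distance 0 from 0. *)
- move=> [s [m [_ ms]] sG]; pose M := Metric.Pack m.
  pose V n := [set x | mdist ((0 : G) : M) x < n.+1%:R^-1].
  have V0 n : nbhs (0 : G) (V n).
    have n0 : 0 < n.+1%:R^-1 :> R by rewrite invr_gt0.
    have := @nbhsx_ballx _ M (0 : G) _ n0; rewrite ballEmdist nbhsE.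
    move=> [B [oB B0] BV]; rewrite nbhsE; exists B => //; split=> //.
    by apply: sG; exact: ms.
  have [rho rhoP rhoV] := countable_norm V V0.
  exists (EFin \o rho); have [H1 H2 cts H4] := EFin_hull_norm rhoP; split=> //.
  apply/seteqP; split=> [x rx|_ ->] /=; last by rewrite norm0.
  have Vx := rho_ker _ _ _ rx rhoV.
  apply/esym/(@mdist_positivity _ M)/eqP; rewrite eq_le mdist_ge0 andbT leNgt.
  apply/negP => /exists_natSinv_lt[n /lt_trans /(_ (Vx n))].
  by rewrite ltxx.
- move=> lambda normL ctsL.
  (* Both signs are imposed because [pseudo_norm_cvg] asks for smallness at [h - g] and at
     [g - h]. *)
  pose V n := [set x | (lambda x < (n.+1%:R^-1)%:E)%E] `&`
              [set x | (lambda (- x)%R < (n.+1%:R^-1)%:E)%E].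
  have V0 n : nbhs (0 : G) (V n).
    have nbhsL : nbhs (0 : G) [set x | (lambda x < (n.+1%:R^-1)%:E)%E].
      apply: (ctsL 0 [set y | (y < (n.+1%:R^-1)%:E)%E]).
      apply: open_nbhs_nbhs; split; first exact: open_ereal_lt_ereal.
      by case: normL => _ /= -> _; rewrite lte_fin invr_gt0.
    by apply: filterI => //; exact: (nbhs0N nbhsL).
  have [rho rhoP rhoV] := countable_norm V V0.
  exists (EFin \o rho); have [H1 H2 cts H4] := EFin_hull_norm rhoP; split=> //.
  move=> g; have FF := nbhs_filter (g : pnorm_space (EFin \o rho)).
  apply: (pseudo_norm_cvg FF normL) => e e0; have [n ne] := exists_natSinv_lt e0.
  apply/(nbhs_pnorm_space rhoP); have [d d0 dV] := rhoV n; exists d => // h.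
  move=> /dV[] /=; rewrite opprB => l1 l2.
  by split; [apply: lt_trans l1 _|apply: lt_trans l2 _]; rewrite lte_fin.
Qed.
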